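(* Let $M$ and $N$ be two locally compact Hausdorff spaces that are countable at infinity, and let $f\colon M\times N\to(0,\infty)$ be a continuous function. Then there are four functions $F\colon M\to(0,\infty)$, $G\colon N\to(0,\infty)$, $\varphi\colon M\to(0,\infty)$ and $\psi\colon N\to(0,\infty)$ such that $$\varphi(t)\psi(x)\leq f(t,x)\leq F(t)G(x)$$ for all $(t,x)\in M\times N$.
   Context: A locally compact Hausdorff space is called countable at infinity if it is $\sigma$-compact, i.e. a countable union of compact subsets; equivalently, it admits an exhaustion $M=\bigcup_{i\in\mathbb{N}_0}K_i$ by compact subsets with $K_0=\emptyset$ and $K_i\subset\mathring{K}_{i+1}$ for all $i$, where $\mathring{K}$ denotes the interior of $K$. The product $M\times N$ carries the product topology. *)

(* Defs.v *)
From HB Require Import structures.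
From mathcomp Require Import all_boot all_order all_algebra.
From mathcomp Require Import all_classical all_reals all_analysis.

Set Implicit Arguments.
Unset Strict Implicit.
Unset Printing Implicit Defensive.

Local Open Scope classical_set_scope.

Definition countable_at_infinity (T : topologicalType) : Prop :=
  exists K : nat -> set T,
    (forall i, compact (K i)) /\ \bigcup_i K i = [set: T].

(* Main.v *)
Require Import Defs.
From HB Require Import structures.
From mathcomp Require Import all_boot all_order all_algebra.
From mathcomp Require Import all_classical all_reals all_analysis.

(** The two spaces are covered by compact sets K_0, K_1, ... and L_0, L_1, ...
    Continuity bounds a function on each compact product K_i x L_j by a number
    B i j, so a point (t, x) only matters through an index i with t in K_i and
    an index j with x in L_j. The problem thus becomes one about double
    sequences of reals, solved in [double_sequence_le_product]: with a n at
    least 1 and above all B i j with i, j <= n, the larger of a i and a j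
    already dominates B i j, and the other factor, being at least 1, does no
    harm. This gives the upper bound ([continuous_le_product]); the lower bound
    is the upper bound for 1 / f, inverted. *)

Set Implicit Arguments.
Unset Strict Implicit.
Unset Printing Implicit Defensive.

Import Order.TTheory GRing.Theory Num.Theory.
Import numFieldNormedType.Exports.

Local Open Scope classical_set_scope.
Local Open Scope ring_scope.

(** For a single index n the finitely many B i j with i, j <= n can be dominated
    at once; asking a >= 1 on top turns the bound a (max i j) into the product
    a i * a j. *)
Lemma double_sequence_le_product (R : realDomainType) (B : nat -> nat -> R) :
  exists a : nat -> R,
    (forall i, 1 <= a i) /\ (forall i j, B i j <= a i * a j).
Proof.
(* Summing absolute values, rather than taking a maximum, makes 1 <= a n and
   the bound on each B i j instances of nonnegativity. *)
pose a n : R := 1 + \sum_(i < n.+1) \sum_(j < n.+1) `|B i j|.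
have a_ge1 n : 1 <= a n.
  by rewrite lerDl; apply: sumr_ge0 => i _; apply: sumr_ge0.
have le_a n i j : (i <= n)%N -> (j <= n)%N -> B i j <= a n.
  move=> le_in le_jn; apply: le_trans (ler_norm _) _.
  rewrite /a (bigD1 (Ordinal (le_in : (i < n.+1)%N))) //=.
  rewrite (bigD1 (Ordinal (le_jn : (j < n.+1)%N))) //= -!addrA [leRHS]addrCA lerDl.
  by do !apply: addr_ge0 => //; apply: sumr_ge0 => // k _; apply: sumr_ge0.
have a_ge0 n : 0 <= a n by apply: le_trans (a_ge1 n).
exists a; split=> // i j; have [le_ij | /ltnW le_ji] := leqP i j.
  by apply: le_trans (le_a j i j le_ij (leqnn j)) _; rewrite ler_peMl.
by apply: le_trans (le_a i i j (leqnn i) le_ji) _; rewrite ler_peMr.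
Qed.

Lemma continuous_compact_setX_ubound (R : realType) (M N : topologicalType)
    (g : M * N -> R) (K : set M) (L : set N) :
  continuous g -> compact K -> compact L ->
  exists b, forall t x, K t -> L x -> g (t, x) <= b.
Proof.
move=> g_cont cK cL.
have /compact_bounded [b [_ gb]] : compact (g @` (K `*` L)).
  apply: continuous_compact; last exact: compact_setX.
  exact: continuous_subspaceT.
exists (b + 1) => t x Kt Lx; apply: le_trans (ler_norm _) _.
by apply: (gb (b + 1)); [rewrite ltrDl | exists (t, x)].
Qed.

(** F and G depend on a point only through the index of some compact set that
    contains it, which is why they need not be continuous. *)
Lemma continuous_le_product (R : realType) (M N : topologicalType)
    (g : M * N -> R) :
  countable_at_infinity M -> countable_at_infinity N -> continuous g ->
  exists (F : M -> R) (G : N -> R),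
    [/\ forall t, 0 < F t, forall x, 0 < G x
      & forall t x, g (t, x) <= F t * G x].
Proof.
move=> [K [cK Kcover]] [L [cL Lcover]] g_cont.
have /choice [B gB] : forall ij : nat * nat,
    exists b, forall t x, K ij.1 t -> L ij.2 x -> g (t, x) <= b.
  by move=> ij; apply: continuous_compact_setX_ubound.
have /choice [m Km] : forall t, exists i, K i t.
  by move=> t; have : [set: M] t by []; rewrite -Kcover => -[i _ Kt]; exists i.
have /choice [n Ln] : forall x, exists j, L j x.
  by move=> x; have : [set: N] x by []; rewrite -Lcover => -[j _ Lx]; exists j.
have [a [a_ge1 aB]] := double_sequence_le_product (fun i j => B (i, j)).
exists (a \o m), (a \o n); split=> [t | x | t x] /=.
- exact: lt_le_trans (a_ge1 _).
- exact: lt_le_trans (a_ge1 _).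
- exact: le_trans (gB (m t, n x) t x (Km t) (Ln x)) (aB _ _).
Qed.

Theorem corollary2 (R : realType) (M N : topologicalType)
    (lcM : locally_compact [set: M]) (hM : hausdorff_space M)
    (sM : countable_at_infinity M)
    (lcN : locally_compact [set: N]) (hN : hausdorff_space N)
    (sN : countable_at_infinity N)
    (f : M * N -> R) (f_gt0 : forall p : M * N, 0 < f p)
    (f_cont : continuous f) :
  exists (F : M -> R) (G : N -> R) (phi : M -> R) (psi : N -> R),
    (forall t : M, 0 < F t) /\ (forall x : N, 0 < G x) /\
    (forall t : M, 0 < phi t) /\ (forall x : N, 0 < psi x) /\
    forall (t : M) (x : N), phi t * psi x <= f (t, x) <= F t * G x.
Proof.
have [F [G [F_gt0 G_gt0 fFG]]] := continuous_le_product sM sN f_cont.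
have fV_cont : continuous (fun p => (f p)^-1).
  by move=> p; apply: cvgV; [rewrite gt_eqF | exact: f_cont].
have [P [Q [P_gt0 Q_gt0 fPQ]]] := continuous_le_product sM sN fV_cont.
exists F, G, (fun t => (P t)^-1), (fun x => (Q x)^-1).
do !split=> //; try by move=> ?; rewrite invr_gt0.
move=> t x; rewrite fFG andbT -invfM -[leRHS]invrK.
by rewrite lef_pV2 ?posrE ?mulr_gt0 ?invr_gt0.
Qed.
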